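(* Let $\Lambda\subset\mathbb{Z}$ be a finite interval with $|\Lambda|\geq 5$. For any root tiling $R\in\mathcal{R}_\Lambda$, $$\mathcal{G}_\Lambda\cap\mathcal{C}_\Lambda(R)=\mathrm{span}\{\psi_\Lambda(R)\}.$$ Thus the BVMD-states form an orthogonal basis of the ground-state space $\mathcal{G}_\Lambda$: $$\mathcal{G}_\Lambda=\overline{\mathrm{span}}\{\psi_\Lambda(R)\,|\,R\in\mathcal{R}_\Lambda\}.$$
   Context: Standing assumptions: $\kappa>0$, $\lambda\in\mathbb{C}\setminus\{0\}$. Hamiltonian. For a finite interval $\Lambda=[a,b]=\{a,\dots,b\}\subset\mathbb{Z}$, $|\Lambda|=b-a+1$, let $\mathcal{H}_\Lambda=\ell^2(\mathbb{N}_0^\Lambda)$ with orthonormal basis $|\mu\rangle$, $\mu\in\mathbb{N}_0^\Lambda$ (bosonic occupation numbers), $\psi=\sum_\mu\psi(\mu)|\mu\rangle$. With $\delta_x$ the configuration having a single particle at $x$, $$(q_x\psi)(\nu)=\sqrt{(\nu_x+1)(\nu_x+2)}\,\psi(\nu+2\delta_x)-\lambda\sqrt{(\nu_{x-1}+1)(\nu_{x+1}+1)}\,\psi(\nu+\delta_{x-1}+\delta_{x+1}).$$ $H_\Lambda$ (open boundary conditions) is the non-negative self-adjoint operator associated (Friedrichs extension from finite linear combinations of the $|\mu\rangle$) with $$\langle\psi|H_\Lambda\psi\rangle=\sum_{\mu}\Big(\sum_{x=a}^{b-1}\mu_x\mu_{x+1}\Big)|\psi(\mu)|^2+\kappa\sum_{\nu}\sum_{x=a+1}^{b-1}|(q_x\psi)(\nu)|^2,$$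 and $\mathcal{G}_\Lambda=\ker H_\Lambda$. Tilings. A tile is a finite string of occupation numbers covering as many consecutive sites as its length. Bulk tiles: void $V=(0)$, monomer $M=(10)$, dimer $D=(0200)$. Left boundary tiles: $B_n^l=(n00)$, $n\geq 2$. Right boundary tiles: $M^{(1)}=(1)$, $D^{(1)}=(020)$, $B_n^r=(0n)$, $n\geq2$. A BVMD-tiling of $\Lambda$ is an ordered covering $T=(T_1,\dots,T_k)$ of $\Lambda$ from left to right by non-overlapping tiles, where only $T_1$ may be a left boundary tile and only $T_k$ may be a right boundary tile. $\mathcal{T}_\Lambda$ is the set of all BVMD-tilings and $\sigma_\Lambda(T)\in\mathbb{N}_0^\Lambda$ is the configuration read off from $T$. Two tilings are connected, $T\leftrightarrow T'$, if one is obtained from the other by finitely many replacements (in either direction) of neighbouring tiles $(10)(10)\leftrightarrow(0200)$ and $(10)(1)\leftrightarrow(020)$. A root tiling is a BVMD-tiling containing neither $D$ nor $D^{(1)}$; $\mathcal{R}_\Lambda$ is the set of root tilings. For $R\in\mathcal{R}_\Lambda$, $\mathcal{T}_\Lambda(R)=\{T\in\mathcal{T}_\Lambda: T\leftrightarrow R\}$ and $\mathcal{C}_\Lambda(R)=\mathrm{span}\{|\sigma_\Lambda(T)\rangle: T\in\mathcal{T}_\Lambda(R)\}$. The BVMD-state of $R$ is $$\psi_\Lambda(R)=\sum_{T\in\mathcal{T}_\Lambda(R)}\left(\frac{\lambda}{\sqrt2}\right)^{d(T)}|\sigma_\Lambda(T)\rangle,$$ with $d(T)$ the number of tiles $D$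 or $D^{(1)}$ in $T$. *)

(* Defs.v *)
From HB Require Import structures.
From Stdlib Require Import Relations.
From mathcomp Require Import all_boot all_order all_algebra.
From mathcomp Require Import complex.
From mathcomp Require Import all_classical all_reals all_analysis.

Set Implicit Arguments.
Unset Strict Implicit.
Unset Printing Implicit Defensive.

Import Order.TTheory GRing.Theory Num.Theory.
Import numFieldNormedType.Exports.

Local Open Scope classical_set_scope.
Local Open Scope ring_scope.
Local Open Scope complex_scope.

(* The integer interval [a, b] in increasing order, empty when b < a. *)
Definition zinterval (a b : int) : seq int :=
  [seq a + k%:Z | k <- iota 0 (if a <= b then `|b - a|%N.+1 else 0%N)].

Lemma mem_zinterval (a b x : int) : (x \in zinterval a b) = (a <= x <= b).
Proof.
apply/mapP/andP => [[k]|[ax xb]].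
  rewrite mem_iota add0n; case: ifP => // ab /andP[_]; rewrite ltnS => kab ->.
  rewrite lerDl; split=> //.
  by rewrite addrC -lerBrDr -[b - a]gez0_abs ?subr_ge0 ?lez_nat.
have ab : a <= b by exact: le_trans xb.
exists `|x - a|%N; last by rewrite gez0_abs ?subr_ge0// [RHS]addrC subrK.
rewrite mem_iota add0n ab ltnS /=.
by rewrite -lez_nat !gez0_abs ?subr_ge0// lerB.
Qed.

Lemma size_zinterval (a b : int) :
  a <= b -> (size (zinterval a b))%:Z = b - a + 1.
Proof.
move=> ab; rewrite size_map size_iota ab -addn1 PoszD.
by rewrite gez0_abs// subr_ge0.
Qed.

Definition site (a b : int) := seq_sub (zinterval a b).

Definition config (a b : int) := {ffun site a b -> nat}.

(* Occupation number of the site x of mu, read as 0 outside [a, b]. *)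
Definition occ (a b : int) (mu : config a b) (x : int) : nat :=
  if insub x is Some y then mu y else 0%N.

Definition delta {a b : int} (x : int) : config a b :=
  [ffun y => (ssval y == x : nat)].

Section tilings.
Local Open Scope nat_scope.

(* A tile is the string of its occupation numbers; different tiles are
   different strings. *)
Definition tile := seq nat.
Definition tiling := seq tile.

Definition tileV : tile := [:: 0].
Definition tileM : tile := [:: 1; 0].
Definition tileD : tile := [:: 0; 2; 0; 0].
Definition tileM1 : tile := [:: 1].
Definition tileD1 : tile := [:: 0; 2; 0].

Definition bulk_tile : pred tile := mem [:: tileV; tileM; tileD].

Definition left_tile (t : tile) : Prop :=
  exists2 n, 2 <= n & t = [:: n; 0; 0].

Definition right_tile (t : tile) : Prop :=
  t = tileM1 \/ t = tileD1 \/ exists2 n, 2 <= n & t = [:: 0; n].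

Definition is_bvmd (a b : int) (T : tiling) : Prop :=
  size (flatten T) = size (zinterval a b) /\
  forall i, i < size T ->
    let t := nth [::] T i in
    bulk_tile t \/ (i = 0 /\ left_tile t) \/ (i.+1 = size T /\ right_tile t).

Definition tilings (a b : int) : set tiling := [set T | is_bvmd a b T].

Definition sigma (a b : int) (T : tiling) : config a b :=
  [ffun y => nth 0 (flatten T) (absz (ssval y - a)%R)].

Inductive replacement : tiling -> tiling -> Prop :=
| replaceD (S S' : tiling) :
    replacement (S ++ [:: tileM; tileM] ++ S') (S ++ [:: tileD] ++ S')
| replaceD1 (S S' : tiling) :
    replacement (S ++ [:: tileM; tileM1] ++ S') (S ++ [:: tileD1] ++ S').

Definition tconnected : tiling -> tiling -> Prop :=
  clos_refl_sym_trans tiling replacement.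

Definition dimers (T : tiling) : nat :=
  count (mem [:: tileD; tileD1]) T.

Definition root_tilings (a b : int) : set tiling :=
  [set T | tilings a b T /\ tileD \notin T /\ tileD1 \notin T].

Definition tilings_of (a b : int) (T0 : tiling) : set tiling :=
  [set T | tilings a b T /\ tconnected T T0].

End tilings.

Section states.
Context {R : realType}.

Notation abs2 z := (ComplexField.Normc.normc z ^+ 2)%R.

(* Sum of an absolutely summable family. *)
Definition rsum (I : choiceType) (f : I -> R) : R :=
  fine (\esum_(i in [set: I]) (Num.max (f i) 0)%:E) -
  fine (\esum_(i in [set: I]) (Num.max (- f i) 0)%:E).

Definition csum (I : choiceType) (f : I -> R[i]) : R[i] :=
  rsum (fun i => complex.Re (f i)) +i* rsum (fun i => complex.Im (f i)).

Definition state (a b : int) := config a b -> R[i].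

Context {a b : int}.
Local Notation cfg := (config a b).
Local Notation states := (state a b).
Implicit Types (phi psi eta : states) (mu nu : cfg) (A : set states).

Definition ket mu : states := fun nu => (nu == mu)%:R.

Definition norm2 psi : \bar R := \esum_(mu in [set: cfg]) (abs2 (psi mu))%:E.

Definition l2 : set states := [set psi | (norm2 psi < +oo)%E].

Definition inner phi psi : R[i] := csum (fun mu => (phi mu)^* * psi mu).

(* Finite linear combinations of elements of A. *)
Definition lspan A : set states :=
  [set psi | exists n (c : 'I_n -> R[i]) (u : 'I_n -> states),
     (forall i, A (u i)) /\ psi = \sum_(i < n) c i *: u i].

(* The closure of lspan A in l2. *)
Definition closed_span A : set states :=
  [set psi | l2 psi /\
     forall e : R, 0 < e ->
       exists2 phi, lspan A phi & (norm2 (psi - phi)%R < e%:E)%E].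

Variables (kappa : R) (lambda : R[i]).

(* q_x, used for a < x < b only. *)
Definition q (x : int) psi : states := fun nu =>
  (Num.sqrt ((occ nu x + 1) * (occ nu x + 2))%N%:R)%:C *
    psi (nu + delta x *+ 2) -
  lambda * (Num.sqrt ((occ nu (x - 1) + 1) * (occ nu (x + 1) + 1))%N%:R)%:C *
    psi (nu + delta (x - 1) + delta (x + 1)).

Definition potential mu : nat :=
  (\sum_(x <- zinterval a (b - 1)) occ mu x * occ mu (x + 1)%R)%N.

Definition energy psi : \bar R :=
  (\esum_(mu in [set: cfg]) ((potential mu)%:R * abs2 (psi mu))%:E +
   kappa%:E * \esum_(nu in [set: cfg])
     (\sum_(x <- zinterval (a + 1) (b - 1)) abs2 (q x psi nu))%R%:E)%E.

(* The sesquilinear form whose quadratic form is energy; antilinear in its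
   first argument. *)
Definition energy_form phi psi : R[i] :=
  csum (fun mu => (potential mu)%:R * ((phi mu)^* * psi mu)) +
  kappa%:C * csum (fun nu =>
    \sum_(x <- zinterval (a + 1) (b - 1)) (q x phi nu)^* * q x psi nu).

Definition finite_states : set states := lspan (range ket).

(* Domain of the closure of the energy form restricted to finite_states.  The
   closure is the restriction of energy_form to this domain, because energy is
   lower semicontinuous on l2. *)
Definition form_domain : set states :=
  [set psi | l2 psi /\ exists u : nat -> states,
     [/\ forall n, finite_states (u n),
         norm2 (u n - psi)%R @[n --> \oo] --> 0%E &
         forall e : R, 0 < e ->
           \forall m & n \near \oo, (energy (u m - u n)%R < e%:E)%E]].

(* The graph of H, the self-adjoint operator representing the closed form:
   psi is in the domain of H and H psi = eta.  This is the Friedrichs extension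
   of the operator defined on finite_states. *)
Definition H_graph psi eta : Prop :=
  [/\ form_domain psi, l2 eta &
      forall phi, form_domain phi -> energy_form phi psi = inner phi eta].

Definition ground_space : set states := [set psi | H_graph psi 0].

Definition tiling_space (T0 : tiling) : set states :=
  lspan [set ket (sigma a b T) | T in tilings_of a b T0].

(* The index set tilings_of a b T0 is finite. *)
Definition bvmd_state (T0 : tiling) : states :=
  \sum_(T \in tilings_of a b T0)
    (lambda / (Num.sqrt 2)%:C) ^+ dimers T *: ket (sigma a b T).

End states.

Arguments state R a b : clear implicits.
Arguments bvmd_state {R} a b lambda T0.
Arguments ground_space {R} a b kappa lambda.
Arguments tiling_space R a b T0 : clear implicits.

(* Main.v *)
Require Import Defs.
From Stdlib Require Import Relations.
From mathcomp Require Import all_boot all_order all_algebra.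
From mathcomp Require Import complex.
From mathcomp Require Import ring.
From mathcomp Require Import all_classical all_reals all_analysis.

Import Order.TTheory GRing.Theory Num.Theory.
Import numFieldNormedType.Exports.
Local Open Scope classical_set_scope.
Local Open Scope ring_scope.
Local Open Scope complex_scope.

(* Since H is non-negative, a ground state is a square-summable zero mode: it
   vanishes on configurations with two adjacent occupied sites, and every q_x
   kills it.  Each equation q_x psi nu = 0 links only two configurations, with
   nonzero coefficients, so local patterns that hop to a configuration with
   adjacent particles are excluded; on at least five sites the remaining
   configurations are exactly the BVMD-tilings.  On these the equations fix the
   ratio of amplitudes across (10)(10) <-> (0200) and (10)(1) <-> (020), so psi
   is determined by its values on root tilings.  Particle number is conserved
   and its sectors are finite-dimensional, which settles the questions of form
   domain, finiteness of sums and closure. *)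

(** * Tilings as lists *)

Section combinatorics.
Local Open Scope nat_scope.
Implicit Types (T S : tiling) (t : tile) (l : bool) (u v w : seq nat).

Definition leftb t := if t is [:: _.+2; 0; 0] then true else false.

Definition rightb t := [|| t == tileM1, t == tileD1 |
  if t is [:: 0; n] then 1 < n else false].

(* The flag tells whether the first tile may be a left boundary tile. *)
Fixpoint bvmd_shape l T := if T is t :: T' then
  [|| bulk_tile t, l && leftb t | nilp T' && rightb t] && bvmd_shape false T'
  else true.

Lemma leftP t : leftb t <-> left_tile t.
Proof.
split=> [|[[|[|n]]// _ ->]//].
by case: t => [|[|[|n]] [|[|?] [|[|?] [|? ?]]]]//= _; exists n.+2.
Qed.

Lemma rightP t : rightb t <-> right_tile t.
Proof.
split=> [/or3P[/eqP ->|/eqP ->|]|[->//|[->//|[n n1 ->]]]]; [by left|by right; left| |].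
- by case: t => [|[|?] [|n [|? ?]]]//; right; right; exists n.
- by rewrite /rightb n1 !orbT.
Qed.

Lemma shapeP l T : bvmd_shape l T <-> forall i, i < size T ->
    let t := nth [::] T i in
    bulk_tile t \/ (l /\ i = 0 /\ left_tile t) \/ (i.+1 = size T /\ right_tile t).
Proof.
elim: T l => [|t T IH] l; first by split.
split=> [/= /andP[tP /IH TP] [_|i ilt]|h] /=.
- case/or3P: tP => [->|/andP[-> /leftP ?]|/andP[/nilP -> /rightP ?]]; first by left.
  + by right; left.
  + by right; right.
- by case: (TP i ilt) => [?|[[]//|[<- ?]]]; [left|right; right].
apply/andP; split; last first.
  apply/IH => i ilt; have := h i.+1 ilt => /= -[?|[[_ []//]|[[<-] ?]]].
    by left.
  by right; right.
have /= := h 0 isT => -[->//|[[-> [_ /leftP ->]]|[[/esym/size0nil ->] /rightP ->]]].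
  by rewrite orbT.
by rewrite !orbT.
Qed.

Lemma is_bvmdP a b T :
  is_bvmd a b T <-> size (flatten T) = size (zinterval a b) /\ bvmd_shape true T.
Proof.
split=> -[sT h]; split=> //; first apply/shapeP.
- by move=> i /h[?|[[? ?]|?]]; [left|right; left|right; right].
- by move/shapeP : h => h i /h[?|[[_ ?]|?]]; [left|right; left|right; right].
Qed.

(** A view on the head of a well-formed tiling. A right boundary tile comes with the fact that
    nothing follows it, every other tile with a well-formed tail in which left boundary tiles are
    excluded. *)
Variant tile_spec l T : tile -> Prop :=
| SpecV of bvmd_shape false T : tile_spec l T tileV
| SpecM of bvmd_shape false T : tile_spec l T tileM
| SpecD of bvmd_shape false T : tile_spec l T tileD
| SpecL n of l & bvmd_shape false T : tile_spec l T [:: n.+2; 0; 0]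
| SpecM1 of T = [::] : tile_spec l T tileM1
| SpecD1 of T = [::] : tile_spec l T tileD1
| SpecR n of T = [::] : tile_spec l T [:: 0; n.+2].

Lemma tile_specP l T t : bvmd_shape l (t :: T) -> tile_spec l T t.
Proof.
move=> /= /andP[tP TP].
case/or3P: tP => [|/andP[ll /leftP[[|[|n]]// _ ->]]|]; last 2 first.
- exact: SpecL.
- move=> /andP[/nilP -> /rightP[->|[->|[[|[|n]]// _ ->]]]].
  + exact: SpecM1.
  + exact: SpecD1.
  + exact: SpecR.
rewrite /bulk_tile /= !inE => /or3P[]/eqP->.
- exact: SpecV.
- exact: SpecM.
- exact: SpecD.
Qed.

(** Only a left boundary tile begins with at least two particles. This distinguishes a void from the
    other tiles that begin with 0. *)
Lemma shape_head T n w : bvmd_shape false T -> flatten T <> n.+2 :: w.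
Proof. by case: T => [//|t T] /tile_specP[]. Qed.

(** The tiling can be read off from the left. Two heads that agree on their first entry differ
    either in where the string ends or because one of them would need a tail beginning with at least
    2, against [shape_head]. *)
Lemma flatten_shape_inj l T T' :
  bvmd_shape l T -> bvmd_shape l T' -> flatten T = flatten T' -> T = T'.
Proof.
elim: T l T' => [|t T IH] l [|t' T'] //.
- by move=> _ /tile_specP[].
- by move=> /tile_specP[].
move=> /tile_specP[hT|hT|hT|n ll hT|hT|hT|n hT]
  /tile_specP[hT'|hT'|hT'|n' _ hT'|hT'|hT'|n' hT'] //=;
  rewrite ?hT ?hT' //=; try (by case=> /(IH _ _ hT hT') ->);
  try (by case=> /(shape_head _ _ _ hT)); try (by case=> /esym/(shape_head _ _ _ hT')).
- by case=> -> /(IH _ _ hT hT') ->.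
- by case=> ->.
Qed.

(** The void appended to [S] stands for the nonempty rest: it is allowed everywhere and forbids a
    right boundary tile at the end of [S]. *)
Lemma shape_cat l S t T :
  bvmd_shape l (S ++ t :: T) = bvmd_shape l (rcons S tileV) && bvmd_shape (l && nilp S) (t :: T).
Proof.
elim: S l => [|s S IH] l; first by rewrite /= andbT.
rewrite cat_cons rcons_cons [LHS]/= [bvmd_shape l (_ :: rcons _ _)]/= IH !andbF andbA.
by congr (_ && _ && _); rewrite /nilp size_cat size_rcons addnS.
Qed.

Lemma shape_replacement l T T' : replacement T T' -> bvmd_shape l T = bvmd_shape l T'.
Proof.
by case=> {T T'} S S'; rewrite 2!cat_cons shape_cat [in RHS]cat_cons [RHS]shape_cat;
  congr andb; rewrite /= ?andbF ?orbF //=; case: nilp.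
Qed.

(** Both replacements act on the string as 101 -> 020, the hop described by [q]; the last 0 of
    (10)(10) and (0200) is unchanged and belongs to [v]. *)
Lemma flatten_replacement T T' : replacement T T' -> exists u v,
  flatten T = u ++ [:: 1; 0; 1] ++ v /\ flatten T' = u ++ [:: 0; 2; 0] ++ v.
Proof.
case=> S S'; rewrite !flatten_cat; exists (flatten S).
  by exists (0 :: flatten S').
by exists (flatten S').
Qed.

Lemma replacement_cons t T T' :
  replacement T T' -> replacement (t :: T) (t :: T').
Proof.
by case=> S S'; rewrite -!(cat_cons t S); [exact: replaceD|exact: replaceD1].
Qed.

(** An entry of at least 2 with neighbours on both sides is the 2 of a dimer, because the pile in a
    left (right) boundary tile has no left (right) neighbour. *)
Lemma locate_dimer l T u i j k v : bvmd_shape l T ->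
  flatten T = u ++ [:: i; j.+2; k] ++ v ->
  [/\ i = 0, j = 0 & k = 0] /\
  exists2 T', replacement T' T & flatten T' = u ++ [:: 1; 0; 1] ++ v.
Proof.
have lift t T0 u' : (exists2 T', replacement T' T0 & flatten T' = u' ++ [:: 1; 0; 1] ++ v) ->
    exists2 T', replacement T' (t :: T0) & flatten T' = (t ++ u') ++ [:: 1; 0; 1] ++ v.
  move=> [T' rT' fT']; exists (t :: T'); first exact: replacement_cons.
  by rewrite /= fT' catA.
elim: T l u => [|t T IH] l u; first by case: u.
move=> /tile_specP[hT|hT|hT|n ll hT|->|->|n ->] /=.
- case: u => [|x u] /= [<- e]; first by case/(shape_head _ _ _ hT): e.
  by have [? ?] := IH _ _ hT e; split=> //; exact: (lift tileV T u).
- case: u => [|x [|y u]] //= [<- <- e]; first by case/(shape_head _ _ _ hT): e.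
  by have [? ?] := IH _ _ hT e; split=> //; exact: (lift tileM T u).
- case: u => [|x [|y [|z [|z' u]]]] //=.
  + move=> [<- <- <- <-]; split=> //; exists [:: tileM, tileM & T] => //.
    exact: (replaceD [::] T).
  + by move=> [_ _ _ _ e]; case/(shape_head _ _ _ hT): e.
  + move=> [<- <- <- <- e].
    by have [? ?] := IH _ _ hT e; split=> //; exact: (lift tileD T u).
- case: u => [|x [|y [|z u]]] //=.
  + by move=> [_ _ _ e]; case/(shape_head _ _ _ hT): e.
  + move=> [<- <- <- e].
    by have [? ?] := IH _ _ hT e; split=> //; exact: (lift [:: n.+2; 0; 0] T u).
- by case: u => [|x [|y u]].
- case: u => [|x [|y [|z [|z' u]]]] //=.
  move=> [<- <- <- <-]; split=> //; exists [:: tileM; tileM1] => //.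
  exact: (replaceD1 [::] [::]).
- by case: u => [|x [|y [|z u]]].
Qed.

(** Unless the string ends first, a positive entry outside a monomer is followed by two zeros inside
    its own tile. So the first entry belongs to a monomer, and the next tile, which begins with a
    positive number, is [tileM] or [tileM1]. *)
Lemma locate_monomers l T u i j k v : bvmd_shape l T ->
  flatten T = u ++ [:: i.+1; j; k.+1] ++ v ->
  [/\ i = 0, j = 0 & k = 0] /\
  exists2 T', replacement T T' & flatten T' = u ++ [:: 0; 2; 0] ++ v.
Proof.
have lift t T0 u' : (exists2 T', replacement T0 T' & flatten T' = u' ++ [:: 0; 2; 0] ++ v) ->
    exists2 T', replacement (t :: T0) T' & flatten T' = (t ++ u') ++ [:: 0; 2; 0] ++ v.
  move=> [T' rT' fT']; exists (t :: T'); first exact: replacement_cons.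
  by rewrite /= fT' catA.
elim: T l u => [|t T IH] l u; first by case: u.
move=> /tile_specP[hT|hT|hT|n ll hT|->|->|n ->] /=.
- case: u => [|x u] //= [<- e].
  by have [? ?] := IH _ _ hT e; split=> //; exact: (lift tileV T u).
- case: u => [|x [|y u]] //=.
  + move=> [<- <- e]; case: T IH hT e => [//|t' T] _ /tile_specP[] //=.
    * move=> _ [<- <-]; split=> //; exists [:: tileD & T] => //.
      exact: (replaceD [::] T).
    * move=> -> [<- <-]; split=> //; exists [:: tileD1] => //.
      exact: (replaceD1 [::] [::]).
  + move=> [<- <- e].
    by have [? ?] := IH _ _ hT e; split=> //; exact: (lift tileM T u).
- case: u => [|x [|y [|z [|z' u]]]] //= [<- <- <- <- e].
  by have [? ?] := IH _ _ hT e; split=> //; exact: (lift tileD T u).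
- case: u => [|x [|y [|z u]]] //= [<- <- <- e].
  by have [? ?] := IH _ _ hT e; split=> //; exact: (lift [:: n.+2; 0; 0] T u).
- by case: u => [|x [|y u]].
- by case: u => [|x [|y [|z [|z' u]]]].
- by case: u => [|x [|y [|z u]]].
Qed.

(** Within a tile a positive entry is followed by 0, except at the end of a right boundary tile,
    where the string stops. *)
Lemma shape_not_adjacent l T u m n v :
  bvmd_shape l T -> flatten T <> u ++ [:: m.+1; n.+1] ++ v.
Proof.
elim: T l u => [|t T IH] l u; first by case: u.
move=> /tile_specP[hT|hT|hT|p ll hT|->|->|p ->] /=.
- by case: u => [|x u] //= [_ /(IH _ _ hT)].
- by case: u => [|x [|y u]] //= [_ _ /(IH _ _ hT)].
- by case: u => [|x [|y [|z [|z' u]]]] //= [_ _ _ _ /(IH _ _ hT)].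
- by case: u => [|x [|y [|z u]]] //= [_ _ _ /(IH _ _ hT)].
- by case: u => [|x [|y u]].
- by case: u => [|x [|y [|z [|z' u]]]].
- by case: u => [|x [|y [|z u]]].
Qed.

Definition root_tile t : tiling :=
  if t == tileD then [:: tileM; tileM]
  else if t == tileD1 then [:: tileM; tileM1] else [:: t].

(** Normal form for connectedness: splitting all dimers is invariant under replacements and leads to
    a connected tiling, so each class contains exactly one root tiling. *)
Definition root_of T : tiling := flatten (map root_tile T).

Lemma root_of_cat S T : root_of (S ++ T) = root_of S ++ root_of T.
Proof. by rewrite /root_of map_cat flatten_cat. Qed.

Lemma root_of_connected T T' : tconnected T T' -> root_of T = root_of T'.
Proof.
elim=> {T T'} [T T'| | |T T' T'' _ -> _ ->]//.
by case=> S S'; rewrite !root_of_cat.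
Qed.

Lemma connected_cons t T T' :
  tconnected T T' -> tconnected (t :: T) (t :: T').
Proof.
elim=> {T T'} [T T' r|T|T T' _ r|T T' T'' _ r _ r'].
- by apply: rst_step; exact: replacement_cons.
- exact: rst_refl.
- exact: rst_sym.
- exact: rst_trans r r'.
Qed.

Lemma connected_root_of T : tconnected T (root_of T).
Proof.
elim: T => [|t T IH]; first exact: rst_refl.
rewrite /root_of /= /root_tile.
case: eqP => [->|_]; last case: eqP => [->|_]; last exact: connected_cons.
- apply: (rst_trans _ _ _ [:: tileM, tileM & T]).
    by apply: rst_sym; apply: rst_step; exact: (replaceD [::] T).
  by do 2 apply: connected_cons.
- apply: (rst_trans _ _ _ [:: tileM, tileM1 & T]).
    by apply: rst_sym; apply: rst_step; exact: (replaceD1 [::] T).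
  by do 2 apply: connected_cons.
Qed.

Lemma root_ofE T : tileD \notin T -> tileD1 \notin T -> root_of T = T.
Proof.
elim: T => [//|t T IH]; rewrite !inE !negb_or => /andP[tD TD] /andP[tD1 TD1].
by rewrite -{2}IH// /root_of /= /root_tile eq_sym (negbTE tD) eq_sym (negbTE tD1).
Qed.

Lemma dimers_root_of T : (tileD \notin root_of T) && (tileD1 \notin root_of T).
Proof.
elim: T => [//|t T]; rewrite /root_of /= !mem_cat !negb_or -!andbA.
move=> /andP[-> ->]; rewrite andbT /root_tile.
case: eqP => [//|/eqP tD]; case: eqP => [//|/eqP tD1].
by rewrite !inE eq_sym tD eq_sym tD1.
Qed.

Lemma dimers_root T : tileD \notin T -> tileD1 \notin T -> dimers T = 0.
Proof.
move=> TD TD1; apply/eqP; rewrite -leqn0 leqNgt -has_count; apply/hasP => -[t tT].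
by rewrite /= !inE => /orP[]/eqP e; move: TD TD1; rewrite -e tT.
Qed.

Lemma dimers_replacement T T' : replacement T T' -> dimers T' = (dimers T).+1.
Proof. by case=> S S'; rewrite /dimers !count_cat /= addnS. Qed.

(** The last component is conservation of the particle number, which later makes the classes
    finite. *)
Lemma connected_invariant T T' : tconnected T T' ->
  [/\ bvmd_shape true T = bvmd_shape true T', size (flatten T) = size (flatten T')
    & sumn (flatten T) = sumn (flatten T')].
Proof.
elim=> {T T'} [T T' r|T//|T T' _ [-> -> ->]//|T T' T'' _ [-> -> ->]//].
split; first exact: shape_replacement.
  by have [u [v [-> ->]]] := flatten_replacement _ _ r; rewrite !size_cat.
by have [u [v [-> ->]]] := flatten_replacement _ _ r; rewrite !sumn_cat.
Qed.

End combinatorics.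

(** * Zero modes *)

Section configurations.
Variables (a b : int).
Local Notation n := (size (zinterval a b)).
Implicit Types (s u v w : seq nat) (mu nu : config a b).

(** Convertible to [sigma] on flattened tilings, so facts about words transfer to tilings
    directly. *)
Definition cfg s : config a b := [ffun y => nth 0%N s `|ssval y - a|%N].

Definition word mu : seq nat := mkseq (fun k => occ mu (a + k%:Z)) n.

Lemma ltn_size_zinterval k : (k < n)%N = (a + k%:Z <= b).
Proof.
have := mem_zinterval a b (a + k%:Z); rewrite lerDl /= => <-; rewrite /zinterval.
have inj : injective (fun k : nat => a + k%:Z) by move=> ? ? /addrI [].
by rewrite [RHS](mem_map inj) mem_iota size_map size_iota.
Qed.

Lemma siteE (y : site a b) : ssval y = a + `|ssval y - a|%N%:Z.
Proof.
have := ssvalP y; rewrite mem_zinterval => /andP[ay _].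
by rewrite gez0_abs ?subr_ge0// [RHS]addrC subrK.
Qed.

Lemma ltn_site (y : site a b) : (`|ssval y - a| < n)%N.
Proof.
by rewrite ltn_size_zinterval -siteE; have := ssvalP y; rewrite mem_zinterval => /andP[].
Qed.

Lemma mem_site k : (a + k%:Z \in zinterval a b) = (k < n)%N.
Proof. by rewrite mem_zinterval lerDl ltn_size_zinterval. Qed.

Lemma occ_cfg s k : size s = n -> occ (cfg s) (a + k%:Z) = nth 0%N s k.
Proof.
move=> sn; rewrite /occ; case: insubP => [y _ yE|].
  by rewrite ffunE -[ssval y]/(val y) yE addrAC subrr add0r.
by rewrite mem_site -leqNgt -sn => ?; rewrite nth_default.
Qed.

Lemma size_word mu : size (word mu) = n.
Proof. exact: size_mkseq. Qed.

Lemma wordK : cancel word cfg.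
Proof.
move=> mu; apply/ffunP => y; rewrite ffunE nth_mkseq ?ltn_site// -siteE.
by rewrite /occ -[ssval y]/(val y) valK.
Qed.

Lemma cfgK s : size s = n -> word (cfg s) = s.
Proof.
move=> sn; apply: (@eq_from_nth _ 0%N) => [|i]; rewrite size_word ?sn// => ilt.
by rewrite nth_mkseq// occ_cfg.
Qed.

Lemma cfgD_delta u i v : cfg (u ++ i :: v) + delta (a + (size u)%:Z) = cfg (u ++ i.+1 :: v).
Proof.
apply/ffunP => y; rewrite !ffunE [X in X == _]siteE (inj_eq (addrI a)) eqz_nat.
set m := `|_|%N; rewrite !nth_cat.
case: ltngtP => [mu|um|->]; rewrite ?addr0 //; last by rewrite subnn /= -[LHS]/(_ + 1)%N addn1.
by rewrite -(subnSK um).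
Qed.

Lemma potential_adjacent u i j v : size (u ++ [:: i.+1, j.+1 & v]) = n ->
  potential (cfg (u ++ [:: i.+1, j.+1 & v])) <> 0%N.
Proof.
set s := u ++ _ => sn; apply/eqP; rewrite -lt0n.
have ux : a + (size u)%:Z \in zinterval a (b - 1).
  rewrite mem_zinterval lerDl /= lerBrDr -addrA -PoszD -ltn_size_zinterval -sn.
  by rewrite size_cat /= addn1 !addnS !ltnS leq_addr.
rewrite /potential (big_rem _ ux) /= addn_gt0; apply/orP; left.
rewrite -addrA -PoszD !occ_cfg// !nth_cat ltnn subnn /= -ltn_subRL subnn ltn0.
by rewrite addKn.
Qed.

Lemma potential_neq0 mu : potential mu <> 0%N ->
  exists u i j v, word mu = u ++ [:: i.+1, j.+1 & v].
Proof.
move=> pot; suff [k k2 /andP[]] : exists2 k, (k.+1 < n)%N &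
    (0 < nth 0 (word mu) k)%N && (0 < nth 0 (word mu) k.+1)%N.
  rewrite !lt0n => k0 k1; exists (take k (word mu)), (nth 0 (word mu) k).-1,
    (nth 0 (word mu) k.+1).-1, (drop k.+2 (word mu)).
  rewrite !prednK ?lt0n// -!drop_nth ?cat_take_drop// ?size_word//.
  exact: ltn_trans k2.
apply: contrapT => h; apply: pot; rewrite /potential big_seq big1// => x.
rewrite mem_zinterval => /andP[ax xb]; apply/eqP; rewrite muln_eq0.
have xE : x = a + `|x - a|%N%:Z by rewrite gez0_abs ?subr_ge0// [RHS]addrC subrK.
move: xb; rewrite xE lerBrDr -addrA -PoszD addn1 -ltn_size_zinterval => k1.
rewrite -[X in X || _]negbK -[X in _ || X]negbK -negb_and -!lt0n; apply/negP => pp.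
by apply: h; exists `|x - a|%N => //; rewrite !nth_mkseq// (ltn_trans _ k1).
Qed.

(** An interior site has both neighbours, so every word splits into three letters centred there and
    the remaining prefix and suffix. This turns [q] into an operation on words. *)
Lemma interior_cfg x nu : x \in zinterval (a + 1) (b - 1) ->
  exists u i j k v, [/\ size (u ++ [:: i, j, k & v]) = n, x = a + (size u).+1%:Z
    & nu = cfg (u ++ [:: i, j, k & v])].
Proof.
rewrite mem_zinterval => /andP[ax xb].
have xE : x = a + `|x - (a + 1)%R|%N.+1%:Z.
  by rewrite -addn1 PoszD gez0_abs ?subr_ge0// (addrC (x - _)) addrA [RHS]addrC subrK.
(* [m] is the offset from [a] of the left neighbour of [x]; the three letters sit at [m], [m.+1] and
   [m.+2]. *)
set m := `|_|%N in xE.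
have mn : (m.+2 < n)%N.
  by move: xb; rewrite xE lerBrDr -addrA -PoszD addn1 -ltn_size_zinterval.
exists (take m (word nu)), (nth 0 (word nu) m)%N, (nth 0 (word nu) m.+1)%N,
  (nth 0 (word nu) m.+2)%N, (drop m.+3 (word nu)).
have m1 := ltn_trans (ltnSn _) mn; have m0 := ltn_trans (ltnSn _) m1.
rewrite -!drop_nth ?size_word// cat_take_drop; split=> //; first exact: size_word.
  by rewrite size_takel ?size_word ?(ltnW m0).
by rewrite wordK.
Qed.

Lemma interior_site u i j k v : size (u ++ [:: i, j, k & v]) = n ->
  a + (size u).+1%:Z \in zinterval (a + 1) (b - 1).
Proof.
move=> sn; rewrite mem_zinterval lerBrDr -addrA -PoszD -ltn_size_zinterval -sn.
by rewrite lerD2l lez_nat size_cat /= addn1 !addnS !ltnS leq_addr.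
Qed.

End configurations.

Arguments cfg a b s : clear implicits.

(** * The zero-mode equations on words *)

Section zero_modes.
Variables (R : realType) (lambda : R[i]) (a b : int).
Local Notation n := (size (zinterval a b)).
Local Notation cfg := (cfg a b).
Implicit Types (s u v w : seq nat) (mu nu : config a b) (psi : state R a b).

Lemma q_cfg psi u i j k v : size (u ++ [:: i, j, k & v]) = n ->
  q lambda (a + (size u).+1%:Z) psi (cfg (u ++ [:: i, j, k & v])) =
  (Num.sqrt (((j + 1) * (j + 2))%N%:R))%:C * psi (cfg (u ++ [:: i, j.+2, k & v])) -
  lambda * (Num.sqrt (((i + 1) * (k + 1))%N%:R))%:C *
    psi (cfg (u ++ [:: i.+1, j, k.+1 & v])).
Proof.
move=> sn; rewrite /q.
have -> : a + (size u).+1%:Z - 1 = a + (size u)%:Z by rewrite -addn1 PoszD addrA addrK.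
have -> : a + (size u).+1%:Z + 1 = a + (size u).+2%:Z by rewrite -addrA -PoszD addn1.
have nu m w : nth 0%N (u ++ w) (m + size u) = nth 0%N w m.
  by rewrite nth_cat ltnNge leq_addl addnK.
rewrite !occ_cfg// (nu 0%N) (nu 1%N) (nu 2%N) /=.
have e1 i' : size (rcons u i') = (size u).+1 by rewrite size_rcons.
have e2 i' : size (rcons (rcons u i') j) = (size u).+2 by rewrite !size_rcons.
have -> : cfg (u ++ [:: i, j, k & v]) + delta (a + (size u).+1%:Z) *+ 2 =
    cfg (u ++ [:: i, j.+2, k & v]).
  by rewrite mulr2n addrA -(e1 i) -cat_rcons !cfgD_delta cat_rcons.
suff -> : cfg (u ++ [:: i, j, k & v]) + delta (a + (size u)%:Z) +
    delta (a + (size u).+2%:Z) = cfg (u ++ [:: i.+1, j, k.+1 & v]) by [].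
by rewrite cfgD_delta -(e2 i.+1) -2!cat_rcons cfgD_delta !cat_rcons.
Qed.

(** Termwise vanishing of the two non-negative sums in the energy. Square-summability is kept
    separate, so that the study of amplitudes is purely algebraic. *)
Definition zero_mode psi : Prop :=
  (forall mu, potential mu <> 0%N -> psi mu = 0) /\
  (forall x nu, x \in zinterval (a + 1) (b - 1) -> q lambda x psi nu = 0).

Lemma zero_modeP psi : zero_mode psi <->
  (forall u i j v, size (u ++ [:: i.+1, j.+1 & v]) = n ->
    psi (cfg (u ++ [:: i.+1, j.+1 & v])) = 0) /\
  (forall u i j k v, size (u ++ [:: i, j, k & v]) = n ->
    (Num.sqrt (((j + 1) * (j + 2))%N%:R))%:C * psi (cfg (u ++ [:: i, j.+2, k & v])) =
    lambda * (Num.sqrt (((i + 1) * (k + 1))%N%:R))%:C *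
      psi (cfg (u ++ [:: i.+1, j, k.+1 & v]))).
Proof.
split=> [[h1 h2]|[h1 h2]]; split.
- by move=> u i j v sn; apply: h1; exact: potential_adjacent.
- move=> u i j k v sn; apply/eqP; rewrite -subr_eq0 -q_cfg// h2//.
  exact: interior_site sn.
- move=> mu /potential_neq0[u [i [j [v e]]]].
  by rewrite -(wordK _ _ mu) e h1// -e size_word.
- move=> x nu /(interior_cfg _ _ _ nu)[u [i [j [k [v [sn -> ->]]]]]].
  by rewrite q_cfg// h2// subrr.
Qed.

End zero_modes.

(** * Excluded patterns, support and amplitude ratios of a zero mode *)

Section zero_mode_values.
Variables (R : realType) (lambda : R[i]) (a b : int) (psi : state R a b).
Hypotheses (lambda_neq0 : lambda != 0) (zm : zero_mode R lambda a b psi).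
Local Notation n := (size (zinterval a b)).
Local Notation cfg := (cfg a b).
Local Notation c := (lambda / (Num.sqrt 2)%:C).
Implicit Types (s u v w : seq nat) (T : tiling).

Lemma zero_mode_adjacent u i j v : size (u ++ [:: i.+1, j.+1 & v]) = n ->
  psi (cfg (u ++ [:: i.+1, j.+1 & v])) = 0.
Proof. by move: zm => /zero_modeP[+ _]; apply. Qed.

Lemma sqrtC_neq0 m : (0 < m)%N -> (Num.sqrt (m%:R : R))%:C != 0.
Proof. by move=> m0; rewrite -[0]/(0%:C) (inj_eq (@complexI _)) gt_eqF// sqrtr_gt0 ltr0n. Qed.

(** Both coefficients of the two-term equation are nonzero, as [lambda] is and the square roots are
    positive. The exclusions below all hop to a configuration that is already excluded. *)
Lemma zero_mode_hop u i j k v : size (u ++ [:: i, j, k & v]) = n ->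
  (psi (cfg (u ++ [:: i, j.+2, k & v])) == 0) =
  (psi (cfg (u ++ [:: i.+1, j, k.+1 & v])) == 0).
Proof.
move: zm => /zero_modeP[_ +] sn => /(_ u i j k v sn).
move: (psi _) (psi _) => x y e; apply/eqP/eqP => [x0|y0].
- by apply/eqP; move/esym/eqP: e; rewrite x0 mulr0 !mulf_eq0 (negbTE lambda_neq0)
    (negbTE (sqrtC_neq0 _ _)) ?muln_gt0 ?addn_gt0 ?orbT.
- by apply/eqP; move/eqP: e; rewrite y0 mulr0 !mulf_eq0
    (negbTE (sqrtC_neq0 _ _)) ?muln_gt0 ?addn_gt0 ?orbT.
Qed.

Let size_cat_ s s' : size s = size s' -> forall u, size (u ++ s) = n -> size (u ++ s') = n.
Proof. by move=> e u; rewrite !size_cat e. Qed.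

(** Two of at least three particles leave, and one remains next to both of them. *)
Lemma vanish_triple u i j k v : size (u ++ [:: i, j.+3, k & v]) = n ->
  psi (cfg (u ++ [:: i, j.+3, k & v])) = 0.
Proof.
move=> sn; apply/eqP; rewrite zero_mode_hop; last exact: size_cat_ sn.
by apply/eqP; apply: zero_mode_adjacent; exact: size_cat_ sn.
Qed.

Lemma vanish_dimer_next u i j k y v : size (u ++ [:: i, j.+2, k, y.+1 & v]) = n ->
  psi (cfg (u ++ [:: i, j.+2, k, y.+1 & v])) = 0.
Proof.
move=> sn; apply/eqP; rewrite zero_mode_hop; last exact: size_cat_ sn.
rewrite -2!cat_rcons; apply/eqP; apply: zero_mode_adjacent; rewrite !cat_rcons.
exact: size_cat_ sn.
Qed.

(** The reverse hop places two particles on the empty site beside the remaining pile. *)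
Lemma vanish_pileup_left u i z v : size (u ++ [:: i.+2, 0, z.+1 & v])%N = n ->
  psi (cfg (u ++ [:: i.+2, 0, z.+1 & v])%N) = 0.
Proof.
move=> sn; apply/eqP; rewrite -zero_mode_hop; last exact: size_cat_ sn.
by apply/eqP; apply: zero_mode_adjacent; exact: size_cat_ sn.
Qed.

Lemma vanish_pileup_right u i z v : size (u ++ [:: z.+1, 0, i.+2 & v])%N = n ->
  psi (cfg (u ++ [:: z.+1, 0, i.+2 & v])%N) = 0.
Proof.
move=> sn; apply/eqP; rewrite -zero_mode_hop; last exact: size_cat_ sn.
rewrite -cat_rcons; apply/eqP; apply: zero_mode_adjacent; rewrite !cat_rcons.
exact: size_cat_ sn.
Qed.

(** Splitting the dimer puts a single particle at distance two from the pile, the pattern of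
    [vanish_pileup_right]; the next lemma is the mirror image. *)
Lemma vanish_dimer_pileup u i v : size (u ++ [:: 0, 2, 0, 0, i.+2 & v])%N = n ->
  psi (cfg (u ++ [:: 0, 2, 0, 0, i.+2 & v])%N) = 0.
Proof.
move=> sn; apply/eqP; rewrite zero_mode_hop; last exact: size_cat_ sn.
rewrite -2!cat_rcons; apply/eqP; apply: vanish_pileup_right; rewrite !cat_rcons.
exact: size_cat_ sn.
Qed.

Lemma vanish_pileup_dimer u i k v : size (u ++ [:: i.+2, 0, 0, 2, k & v])%N = n ->
  psi (cfg (u ++ [:: i.+2, 0, 0, 2, k & v])%N) = 0.
Proof.
move=> sn; rewrite -2!cat_rcons; apply/eqP; rewrite zero_mode_hop; last first.
  by rewrite !cat_rcons; exact: size_cat_ sn.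
rewrite !cat_rcons; apply/eqP; apply: vanish_pileup_left; exact: size_cat_ sn.
Qed.

(** A greedy parser, by induction on the length of [w], with [u] the part already read. The bound on
    the head excludes a pile that only a left boundary tile could begin with; it holds for the empty
    word by the default 0. *)
Lemma parse_tail u w : size (u ++ w) = n -> psi (cfg (u ++ w)) <> 0 ->
  (head 0%N w <= 1)%N -> exists2 T, bvmd_shape false T & flatten T = w.
Proof.
have [m] := ubnP (size w); elim: m => [//|m IH] in u w *.
(* [step] reads a bulk tile [t]: it moves into the prefix, and the induction hypothesis tiles the
   rest. *)
have step t w' : (0 < size t)%N -> size (u ++ t ++ w') = n ->
    psi (cfg (u ++ t ++ w')) <> 0 ->
    (size (t ++ w') < m.+1)%N -> (head 0%N w' <= 1)%N ->
    bulk_tile t -> exists2 T, bvmd_shape false T & flatten T = t ++ w'.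
  move=> t0 sn nz; rewrite size_cat => st hw' tb.
  have [||//|//|T sT <-] := IH (u ++ t) w'; rewrite -?catA//.
    by rewrite -ltnS (leq_trans _ st)// ltnS -[X in (X < _)%N]add0n ltn_add2r.
  by exists (t :: T) => //=; rewrite tb.
have last_tile t : rightb t -> exists2 T, bvmd_shape false T & flatten T = t.
  by move=> tr; exists [:: t]; rewrite /= ?cats0// tr !orbT.
case: w => [_ _ _ _|[|[|//]] [|x w]]; first by exists [::].
- by exists [:: tileV].
- case: x => [|[|x]] sw sn nz _.
  + exact: (step tileV (0%N :: w)).
  + exact: (step tileV (1%N :: w)).
  (* The word begins with 0 and then at least 2. If it stops there it is a right boundary tile;
     otherwise the exclusions force exactly 2, then zeros up to the end of a dimer. *)
  case: w sw sn nz => [|k w] sw sn nz.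
    by apply: last_tile; rewrite /rightb /= !orbT.
  case: x sw sn nz => [|x] sw sn nz; last by case: nz; exact: vanish_triple.
  case: k sw sn nz => [|k] sw sn nz; last first.
    by case: nz; move: sn; rewrite -cat_rcons; exact: zero_mode_adjacent.
  case: w sw sn nz => [|[|y] w] sw sn nz; first exact: last_tile.
    have [h|] := leqP (head 0%N w) 1; first exact: (step tileD w).
    case: w sw sn nz => [//|[|[|i]] w]// sw sn nz _.
    by case: nz; exact: vanish_dimer_pileup.
  by case: nz; exact: vanish_dimer_next.
- by move=> _ _ _ _; exact: last_tile.
- case: x => [|x] sw sn nz _; last by case: nz; exact: zero_mode_adjacent.
  have [h|] := leqP (head 0%N w) 1; first exact: (step tileM w).
  case: w sw sn nz => [//|[|[|i]] w]// sw sn nz _.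
  by case: nz; exact: vanish_pileup_right.
Qed.

(** A leading pile must be the start of a left boundary tile; the rest is parsed. On four sites a
    word [n 0 0 m] with [n] and [m] at least 2 admits no hop and is not a tiling, whence the bound
    5. *)
Lemma zero_mode_support s : (5 <= n)%N -> size s = n -> psi (cfg s) <> 0 ->
  exists2 T, bvmd_shape true T & flatten T = s.
Proof.
move=> n5 sn nz; have [h|] := leqP (head 0%N s) 1.
  have [//|//|//|T sT <-] := @parse_tail [::] s.
  exists T => //; case: T sT => //= t T /andP[/orP[]-> ->]//.
  by rewrite !orbT.
case: s sn nz => [//|[|[|i]]// [|x [|y w]]] sn nz _;
  try by rewrite -sn in n5.
have {n5} w2 : (2 <= size w)%N by rewrite -sn in n5.
case: x nz sn => [|x] nz sn; last by case: nz; exact: (zero_mode_adjacent [::]).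
case: y nz sn => [|y] nz sn; last by case: nz; exact: (vanish_pileup_left [::]).
suff h : (head 0%N w <= 1)%N.
  have [//|//|//|T sT <-] := @parse_tail [:: i.+2; 0; 0]%N w.
  by exists ([:: i.+2; 0; 0]%N :: T) => //=; rewrite sT orbT.
(* A second pile right after the left boundary tile has a right neighbour [k], supplied by the fifth
   site, so it can hop: a pile of exactly 2 falls under [vanish_pileup_dimer], a larger one under
   [vanish_triple]. *)
case: w w2 sn nz => [//|[|[|m]] [|k w]]// _ sn nz; case: nz.
case: m k sn => [|m] [|k] sn.
- exact: (vanish_pileup_dimer [::]).
- exact: (vanish_pileup_dimer [::]).
- exact: (vanish_triple [:: i.+2; 0]%N).
- exact: (vanish_triple [:: i.+2; 0]%N).
Qed.

(** At the word with 000 in place of 101 or 020, the equation has coefficients [sqrt 2] and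
    [lambda]; their quotient is the weight of a dimer. *)
Lemma zero_mode_replacement T T' : replacement T T' -> size (flatten T) = n ->
  psi (sigma a b T') = c * psi (sigma a b T).
Proof.
move=> /flatten_replacement[u [v [e e']]] sn.
have su : size (u ++ [:: 0, 0, 0 & v])%N = n by rewrite -sn e !size_cat.
move: zm => /zero_modeP[_ /(_ _ _ _ _ _ su)] h.
rewrite /sigma -/(cfg _) -/(cfg _) e e'.
have s2 : (Num.sqrt (2 : R))%:C != 0 by exact: (sqrtC_neq0 2).
apply: (mulfI s2); rewrite mulrA (mulrCA _ lambda) divff// mulr1.
by move: h; rewrite sqrtr1 mulr1.
Qed.

(** Dividing by the dimer weights makes the relation symmetric, so that it passes to the closure of
    the replacements. *)
Lemma zero_mode_connected T T' : tconnected T T' -> size (flatten T) = n ->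
  c ^- dimers T * psi (sigma a b T) = c ^- dimers T' * psi (sigma a b T').
Proof.
have c0 : c != 0 by rewrite mulf_neq0// invr_neq0// (sqrtC_neq0 2).
elim=> {T T'} [T T' r|//|T T' r IH|T T' T'' r IH _ IH'] sn.
- rewrite (zero_mode_replacement _ _ r)// (dimers_replacement _ _ r).
  by rewrite exprSr invfM mulrA mulfVK.
- by rewrite IH//; have [_ -> _] := connected_invariant _ _ r.
- by rewrite IH// IH'//; have [_ <- _] := connected_invariant _ _ r.
Qed.

Lemma zero_mode_root T : size (flatten T) = n ->
  psi (sigma a b T) = c ^+ dimers T * psi (sigma a b (root_of T)).
Proof.
move=> sn; have c0 : c != 0 by rewrite mulf_neq0// invr_neq0// (sqrtC_neq0 2).
have := zero_mode_connected _ _ (connected_root_of T) sn.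
have /andP[? ?] := dimers_root_of T.
rewrite (dimers_root (root_of T))// expr0 invr1 mul1r => <-.
by rewrite mulVKf// expf_neq0.
Qed.

End zero_mode_values.

(** * BVMD-states *)

Section root_tilings.
Variables (a b : int).
Local Notation n := (size (zinterval a b)).
Implicit Types (T : tiling) (mu : config a b).

Lemma is_bvmd_connected T T' : tconnected T T' -> is_bvmd a b T <-> is_bvmd a b T'.
Proof. by move=> /connected_invariant[e1 e2 _]; rewrite !is_bvmdP e1 e2. Qed.

(** Connectedness to a root tiling becomes an equation between normal forms. *)
Lemma tilings_ofE T0 T : root_tilings a b T0 ->
  tilings_of a b T0 T <-> is_bvmd a b T /\ root_of T = T0.
Proof.
move=> [_ [D0 D1]]; split=> -[TT /=].
- by move=> /root_of_connected ->; split=> //; exact: root_ofE.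
- by move=> <-; split=> //; exact: connected_root_of.
Qed.

Lemma root_tilings_root_of T : is_bvmd a b T -> root_tilings a b (root_of T).
Proof.
move=> TT; split; last exact/andP/dimers_root_of.
exact/(is_bvmd_connected _ _ (connected_root_of T)).
Qed.

Lemma size_bvmd T : is_bvmd a b T -> size (flatten T) = n.
Proof. by case. Qed.

Lemma sigma_inj T T' : is_bvmd a b T -> is_bvmd a b T' ->
  sigma a b T = sigma a b T' -> T = T'.
Proof.
move=> /is_bvmdP[sT hT] /is_bvmdP[sT' hT'] /(congr1 (word a b)).
by rewrite [LHS](cfgK _ _ _ sT) [RHS](cfgK _ _ _ sT'); exact: flatten_shape_inj hT hT'.
Qed.

Lemma finite_bounded_configs N : finite_set [set mu : config a b | forall y, (mu y <= N)%N].
Proof.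
apply: (@sub_finite_set _ _ ((fun f : {ffun site a b -> 'I_N.+1} =>
    [ffun y => val (f y)] : config a b) @` setT)).
  move=> mu muN; exists [ffun y => inord (mu y)] => //.
  by apply/ffunP => y; rewrite !ffunE /= inordK// ltnS.
by apply: finite_image; exact: finite_finset.
Qed.

Lemma nth_le_sumn (s : seq nat) k : (nth 0 s k <= sumn s)%N.
Proof.
elim: s k => [|i s IH] [|k] //=; first exact: leq_addr.
by rewrite (leq_trans (IH k))// leq_addl.
Qed.

Lemma finite_configs_sumn N : finite_set [set mu : config a b | (sumn (word a b mu) <= N)%N].
Proof.
apply: sub_finite_set (finite_bounded_configs N) => mu /= muN y.
by rewrite -(wordK _ _ mu) ffunE (leq_trans (nth_le_sumn _ _)).
Qed.

(** Since [sigma] is injective on tilings, the chosen preimage [decode] recovers each tiling from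
    its configuration. *)
Lemma finite_sigma_preimage (B : set (config a b)) : finite_set B ->
  finite_set [set T | is_bvmd a b T /\ B (sigma a b T)].
Proof.
move=> finB; pose decode mu := xget [::] [set T | is_bvmd a b T /\ sigma a b T = mu].
apply: (@sub_finite_set _ _ (decode @` B)); last exact: finite_image.
move=> T [TT BT]; exists (sigma a b T) => //.
by apply: xget_subset1 => // T1 T2 [T1T e1] [T2T e2]; apply: sigma_inj; rewrite ?e1.
Qed.

Lemma finite_tilings_of T0 : root_tilings a b T0 -> finite_set (tilings_of a b T0).
Proof.
move=> rT0; apply: sub_finite_set (finite_sigma_preimage _
  (finite_configs_sumn (sumn (flatten T0)))) => T [TT /= conn].
split=> //=; rewrite [word _ _ _](cfgK _ _ _ (size_bvmd _ TT)).
by have [_ _ ->] := connected_invariant _ _ conn.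
Qed.

End root_tilings.

(** * Amplitudes of the BVMD-states and their zero-mode property *)

Section bvmd_states.
Variables (R : realType) (lambda : R[i]) (a b : int).
Hypothesis lambda_neq0 : lambda != 0.
Local Notation n := (size (zinterval a b)).
Local Notation c := (lambda / (Num.sqrt 2)%:C).
Local Notation psi T0 := (bvmd_state a b lambda T0).
Implicit Types (T : tiling) (mu : config a b).

Lemma bvmd_stateE T0 mu : root_tilings a b T0 ->
  psi T0 mu = \sum_(T \in tilings_of a b T0) c ^+ dimers T * (mu == sigma a b T)%:R.
Proof.
move=> rT0; rewrite /bvmd_state !fsbig_finite; do ?exact: finite_tilings_of.
by rewrite fct_sumE.
Qed.

(** By injectivity of [sigma], at most one term of the sum survives. *)
Lemma bvmd_state_sigma T0 T : root_tilings a b T0 -> is_bvmd a b T ->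
  psi T0 (sigma a b T) = if root_of T == T0 then c ^+ dimers T else 0.
Proof.
move=> rT0 TT; rewrite bvmd_stateE//; case: eqP => [rT|rT].
  rewrite -(fsbig_widen [set T]) ?fsbig_set1 ?eqxx ?mulr1//.
    by move=> _ ->; exact/tilings_ofE.
  move=> T' [/tilings_ofE[]// T'T _ /eqP neT] /=.
  case: eqP => [e|]; last by rewrite mulr0.
  by case/eqP: neT; apply: sigma_inj (esym e).
rewrite fsbig1// => T' /tilings_ofE[]// T'T rT'; case: eqP => [e|]; last by rewrite mulr0.
by case: rT; rewrite (sigma_inj _ _ _ _ TT T'T e).
Qed.

Lemma bvmd_state_support T0 mu : root_tilings a b T0 -> psi T0 mu <> 0 ->
  exists T, [/\ is_bvmd a b T, root_of T = T0 & mu = sigma a b T].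
Proof.
move=> rT0; rewrite bvmd_stateE// => nz; apply: contrapT => h; apply: nz.
apply: fsbig1 => T /tilings_ofE[]// TT rT; case: eqP => [e|]; last by rewrite mulr0.
by case: h; exists T.
Qed.

Lemma bvmd_state_neq0 T0 : root_tilings a b T0 -> psi T0 <> 0.
Proof.
move=> rT0; have [T0T [D0 D1]] := rT0.
move=> /(congr1 (fun f : state R a b => f (sigma a b T0))); rewrite bvmd_state_sigma//.
by rewrite root_ofE// eqxx dimers_root// => /eqP; rewrite oner_eq0.
Qed.

(** A configuration determines its tiling and hence its root, so the supports are disjoint and
    orthogonality holds term by term. *)
Lemma bvmd_state_disjoint T0 T1 mu : root_tilings a b T0 -> root_tilings a b T1 ->
  T0 <> T1 -> psi T0 mu = 0 \/ psi T1 mu = 0.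
Proof.
move=> r0 r1 ne; have [->|/eqP/bvmd_state_support[//|T [TT rT ->]]] := eqVneq (psi T0 mu) 0.
  by left.
by right; rewrite bvmd_state_sigma// rT; case: eqP.
Qed.

Lemma bvmd_state_cfg T0 s : root_tilings a b T0 -> size s = n ->
  psi T0 (cfg a b s) <> 0 ->
  exists T, [/\ is_bvmd a b T, bvmd_shape true T, root_of T = T0 & flatten T = s].
Proof.
move=> rT0 sn /bvmd_state_support[//|T [TT rT e]]; exists T; split=> //.
  by case/is_bvmdP: TT.
by rewrite -(cfgK _ _ _ (size_bvmd _ _ _ TT)) -(cfgK _ _ _ sn) e.
Qed.

Lemma bvmd_state_hop T0 u v : root_tilings a b T0 ->
  size (u ++ [:: 0, 0, 0 & v])%N = n ->
  (exists T T', [/\ replacement T T', flatten T = (u ++ [:: 1, 0, 1 & v])%N,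
     flatten T' = (u ++ [:: 0, 2, 0 & v])%N, root_of T = T0 & is_bvmd a b T]) ->
  (Num.sqrt 2)%:C * psi T0 (cfg a b (u ++ [:: 0, 2, 0 & v])%N) =
  lambda * psi T0 (cfg a b (u ++ [:: 1, 0, 1 & v])%N).
Proof.
move=> rT0 sn [T [T' [r fT fT' rT TT]]].
have conn : tconnected T T' by exact: rst_step.
have TT' : is_bvmd a b T' by apply/(is_bvmd_connected _ _ _ _ conn).
rewrite -fT -fT' -/(sigma a b T) -/(sigma a b T') !bvmd_state_sigma//.
rewrite -(root_of_connected _ _ conn) rT eqxx (dimers_replacement _ _ r) exprS mulrA.
by rewrite (mulrCA _ lambda) divff ?mulr1// (sqrtC_neq0 R 2).
Qed.

(** If either amplitude in an equation is nonzero, its configuration is a tiling; the location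
    lemmas then make the other one its replacement and reduce the equation to [bvmd_state_hop].
    Otherwise both sides are 0. *)
Lemma bvmd_state_zero_mode T0 : root_tilings a b T0 -> zero_mode R lambda a b (psi T0).
Proof.
move=> rT0; apply/zero_modeP; split=> [u i j v sn|u i j k v sn].
  apply: contrapT => /bvmd_state_cfg[//|//|T [_ hT _]].
  exact: shape_not_adjacent hT.
have hop : [/\ i = 0, j = 0 & k = 0]%N ->
    (exists T T', [/\ replacement T T', flatten T = (u ++ [:: 1, 0, 1 & v])%N,
     flatten T' = (u ++ [:: 0, 2, 0 & v])%N, root_of T = T0 & is_bvmd a b T]) ->
    (Num.sqrt ((j + 1) * (j + 2))%N%:R)%:C * psi T0 (cfg a b (u ++ [:: i, j.+2, k & v])) =
    lambda * (Num.sqrt ((i + 1) * (k + 1))%N%:R)%:C *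
      psi T0 (cfg a b (u ++ [:: i.+1, j, k.+1 & v])).
  move=> [i0 j0 k0] h; rewrite i0 j0 k0 /= in sn *.
  by rewrite sqrtr1 mulr1; exact: bvmd_state_hop.
have [e1|/eqP/bvmd_state_cfg[//||T [TT hT rT fT]]] :=
    eqVneq (psi T0 (cfg a b (u ++ [:: i, j.+2, k & v]))) 0; last first.
- have [ijk [T' r fT']] := locate_dimer _ _ _ _ _ _ _ hT fT.
  apply: hop => //; exists T', T; case: ijk => i0 j0 k0.
  rewrite i0 j0 k0 in fT; have conn : tconnected T' T by exact: rst_step.
  split=> //; first by rewrite (root_of_connected _ _ conn).
  exact/(is_bvmd_connected _ _ _ _ conn).
- by rewrite -sn !size_cat.
have [e2|/eqP/bvmd_state_cfg[//||T [TT hT rT fT]]] :=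
    eqVneq (psi T0 (cfg a b (u ++ [:: i.+1, j, k.+1 & v]))) 0; last first.
- have [ijk [T' r fT']] := locate_monomers _ _ _ _ _ _ _ hT fT.
  apply: hop => //; exists T, T'; case: ijk => i0 j0 k0.
  by rewrite i0 j0 k0 in fT.
- by rewrite -sn !size_cat.
by rewrite e1 e2 !mulr0.
Qed.

End bvmd_states.

(** * Ground states *)

Section sums.
Variable R : realType.
Notation abs2 z := (ComplexField.Normc.normc z ^+ 2)%R.

Lemma rsum0 (I : choiceType) : rsum (fun _ : I => 0 : R) = 0.
Proof. by rewrite /rsum !esum1 ?subrr// => i _; rewrite ?oppr0 maxxx. Qed.

Lemma csum0 (I : choiceType) : csum (fun _ : I => 0 : R[i]) = 0.
Proof. by rewrite /csum /= rsum0. Qed.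

Lemma rsum_ge0 (I : choiceType) (g : I -> R) : (forall i, 0 <= g i) ->
  rsum g = fine (\esum_(i in [set: I]) (g i)%:E).
Proof.
move=> g0; rewrite /rsum [X in _ - fine X]esum1 ?subr0.
  by congr fine; apply: eq_esum => i _; rewrite max_l.
by move=> i _; rewrite max_r// oppr_le0.
Qed.

Lemma csum_ge0 (I : choiceType) (g : I -> R) : (forall i, 0 <= g i) ->
  csum (fun i => (g i)%:C) = (fine (\esum_(i in [set: I]) (g i)%:E))%:C.
Proof. by move=> g0; rewrite /csum /= rsum0 rsum_ge0. Qed.

Lemma esum_finite_support (I : choiceType) (g : I -> R) : (forall i, 0 <= g i) ->
  finite_set [set i | g i <> 0] -> (\esum_(i in [set: I]) (g i)%:E < +oo)%E.
Proof.
move=> g0 fin; rewrite (_ : \esum_(i in _) _ = \esum_(i in [set i | g i <> 0]) (g i)%:E).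
  rewrite esum_fset// => [|i _]; last by rewrite lee_fin.
  by rewrite fsbig_finite//= sumEFin ltry.
rewrite [RHS]esum_mkcond; apply: eq_esum => i _; case: ifPn => //.
by rewrite notin_setE /= => /contrapT ->.
Qed.

(** Finiteness is assumed because [fine] also sends infinity to 0. *)
Lemma fine_esum_eq0 (I : choiceType) (g : I -> R) : (forall i, 0 <= g i) ->
  (\esum_(i in [set: I]) (g i)%:E < +oo)%E ->
  fine (\esum_(i in [set: I]) (g i)%:E) = 0 -> forall i, g i = 0.
Proof.
move=> g0 fin e0 i; apply/eqP; rewrite eq_le g0 andbT.
have {}e0 : \esum_(i in [set: I]) (g i)%:E = 0%E.
  by rewrite -[LHS]fineK ?e0// ge0_fin_numE// esum_ge0// => j _; rewrite lee_fin.
suff: ((g i)%:E <= \esum_(i in [set: I]) (g i)%:E)%E by rewrite e0 lee_fin.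
apply: esum_ge; exists [set i]; first by split=> //; exact: finite_set1.
by rewrite fsbig_set1.
Qed.

Lemma abs2_ge0 (z : R[i]) : 0 <= abs2 z. Proof. exact: sqr_ge0. Qed.

Lemma abs2E (z : R[i]) : abs2 z = complex.Re z ^+ 2 + complex.Im z ^+ 2.
Proof. by case: z => x y /=; rewrite sqr_sqrtr// addr_ge0 ?sqr_ge0. Qed.

Lemma abs2_eq0 (z : R[i]) : (abs2 z == 0) = (z == 0).
Proof.
by rewrite abs2E paddr_eq0 ?sqr_ge0// !sqrf_eq0 [RHS]eq_complex.
Qed.

Lemma abs2_0 : abs2 (0 : R[i]) = 0. Proof. by apply/eqP; rewrite abs2_eq0. Qed.

Lemma mul_conj_abs2 (z : R[i]) : z^*%R * z = (abs2 z)%:C.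
Proof.
rewrite abs2E -[z^*%R]/(conjc z); case: z => x y; apply/eqP; rewrite eq_complex /=.
by rewrite mulNr opprK !expr2 eqxx mulNr (mulrC x) subrr eqxx.
Qed.

End sums.

(** * Ground states as square-summable zero modes *)

Section ground_states.
Variables (R : realType) (kappa : R) (lambda : R[i]) (a b : int).
Hypotheses (kappa_gt0 : 0 < kappa).
Notation abs2 z := (ComplexField.Normc.normc z ^+ 2)%R.
Local Notation n := (size (zinterval a b)).
Local Notation cfg := (cfg a b).
Local Notation zero_mode := (zero_mode R lambda a b).
Local Notation ground := (ground_space a b kappa lambda).
Implicit Types (psi phi : state R a b) (mu nu : config a b) (A : set (state R a b)).

Lemma lspan_sum A (I : eqType) (r : seq I) (c : I -> R[i]) (u : I -> state R a b) :
  (forall i, i \in r -> A (u i)) -> lspan A (\sum_(i <- r) c i *: u i).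
Proof.
move=> Au; exists (size r), (fun i => c (tnth (in_tuple r) i)),
  (fun i => u (tnth (in_tuple r) i)); split=> [i|]; first exact/Au/mem_tnth.
by rewrite big_tnth.
Qed.

Lemma finite_support_finite_states psi :
  finite_set [set mu | psi mu <> 0] -> finite_states psi.
Proof.
move=> fin; have -> : psi = \sum_(mu <- finmap.enum_fset (fset_set [set mu | psi mu <> 0]))
    psi mu *: ket mu.
  rewrite fct_sumE; apply/funext => nu; rewrite -fsbig_finite//=.
  have ketE mu : (psi mu *: ket mu) nu = psi mu * (nu == mu)%:R by [].
  have [nz|/eqP nz] := eqVneq (psi nu) 0.
    rewrite nz fsbig1// => mu mu0; rewrite ketE; case: eqP => [e|]; last by rewrite mulr0.
    by case: mu0; rewrite -e.
  rewrite -(fsbig_widen [set nu]) ?fsbig_set1 ?ketE ?eqxx ?mulr1//.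
    by move=> _ ->.
  by move=> mu [_ ne]; rewrite /= ketE; case: eqP => [e|]; [case: ne|rewrite mulr0].
by apply: lspan_sum => mu _; exists mu.
Qed.

Lemma finite_support_l2 psi : finite_set [set mu | psi mu <> 0] -> l2 psi.
Proof.
move=> fin; apply: esum_finite_support => [mu|]; first exact: abs2_ge0.
apply: sub_finite_set fin => mu /= nz z0; apply: nz; rewrite z0.
by apply/eqP; rewrite abs2_eq0.
Qed.

Lemma norm2_ge psi mu : ((abs2 (psi mu))%:E <= norm2 psi)%E.
Proof.
apply: esum_ge; exists [set mu]; first by split=> //; exact: finite_set1.
by rewrite fsbig_set1.
Qed.

Lemma norm2_0 : norm2 (0 : state R a b) = 0%E.
Proof. by apply: esum1 => mu _; congr EFin; exact: abs2_0. Qed.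

Lemma norm2N psi : norm2 (- psi) = norm2 psi.
Proof. apply: eq_esum => mu _; rewrite -[(- psi) mu]/(- psi mu) !abs2E.
by case: (psi mu) => x y; rewrite /= !sqrrN. Qed.

Lemma q_sub x psi phi nu : q lambda x (psi - phi) nu = q lambda x psi nu - q lambda x phi nu.
Proof.
have subE mu : (psi - phi) mu = psi mu - phi mu by [].
by rewrite /q !subE !mulrBr !opprD !opprK addrACA.
Qed.

Lemma q_0 x nu : q lambda x (0 : state R a b) nu = 0.
Proof. by rewrite /q !mulr0 subr0. Qed.

Lemma zero_mode_sub psi phi : zero_mode psi -> zero_mode phi -> zero_mode (psi - phi).
Proof.
move=> [h1 h2] [h1' h2']; split=> [mu pot|x nu xi].
  by rewrite -[LHS]/(psi mu - phi mu) h1// h1'// subrr.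
by rewrite q_sub h2// h2'// subrr.
Qed.

Lemma zero_mode_energy psi : zero_mode psi -> energy kappa lambda psi = 0%E.
Proof.
move=> [h1 h2]; rewrite /energy !esum1 ?mule0 ?adde0// => [nu _|mu _].
  rewrite big_seq big1// => x xi.
  by rewrite h2// abs2_0.
have [->|/eqP pot] := eqVneq (potential mu) 0%N; first by rewrite mul0r.
by rewrite h1// abs2_0 mulr0.
Qed.

(** The projection onto at most [N] particles, a finite set of configurations; it supplies both test
    states and approximations. *)
Definition trunc N psi : state R a b :=
  fun mu => if (sumn (word a b mu) <= N)%N then psi mu else 0.

Lemma finite_trunc N psi : finite_set [set mu | trunc N psi mu <> 0].
Proof.
apply: sub_finite_set (finite_configs_sumn _ _ N) => mu; rewrite /trunc /=.
by case: ifP.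
Qed.

(** Both configurations read by [q] at [nu] have two particles more than [nu], so they are kept or
    cut together. *)
Lemma q_trunc N psi x nu : x \in zinterval (a + 1) (b - 1) ->
  q lambda x (trunc N psi) nu =
  if ((sumn (word a b nu)).+2 <= N)%N then q lambda x psi nu else 0.
Proof.
move=> /(interior_cfg _ _ _ nu)[u [i [j [k [v [sn -> ->]]]]]].
have sE i' j' k' : size (u ++ [:: i', j', k' & v]) = n by rewrite -sn !size_cat.
rewrite !q_cfg// /trunc !cfgK// !sumn_cat /= !(addSn, addnS).
by case: ifP => // _; rewrite !mulr0 subr0.
Qed.

Lemma zero_mode_trunc N psi : zero_mode psi -> zero_mode (trunc N psi).
Proof.
move=> [h1 h2]; split=> [mu /h1|x nu xi]; first by rewrite /trunc => ->; case: ifP.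
by rewrite q_trunc// h2//; case: ifP.
Qed.

(** A finite set [F] carries the squared norm up to [e], and the truncation error is the mass
    outside a set that contains [F]. *)
Lemma norm2_sub_trunc psi : l2 psi -> forall e : R, 0 < e ->
  exists N, forall m, (N <= m)%N -> (norm2 (psi - trunc m psi)%R < e%:E)%E.
Proof.
move=> psi2 e e0; have psifin : norm2 psi \is a fin_num.
  by rewrite ge0_fin_numE// esum_ge0// => mu _; rewrite lee_fin abs2_ge0.
have [_ [F [finF _] <-]] := ub_ereal_sup_adherent e0 psifin.
rewrite -/(esum _ _) -/(norm2 psi) => ltF.
(* The largest particle number in [F]: truncation from there on keeps all of [F]. *)
exists (\max_(mu <- finmap.enum_fset (fset_set F)) sumn (word a b mu))%N => m Nm.
pose B := [set mu | (sumn (word a b mu) <= m)%N].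
have FB : F `<=` B.
  move=> mu Fmu; rewrite /B /=; apply: leq_trans Nm.
  by apply: leq_bigmax_seq => //; rewrite in_fset_set// inE.
have tail : norm2 (psi - trunc m psi) = \esum_(mu in [set: config a b] `&` ~` B) (abs2 (psi mu))%:E.
  rewrite [RHS]esum_mkcond; apply: eq_esum => mu _.
  rewrite -[(psi - _) mu]/(psi mu - trunc m psi mu) /trunc setTI.
  case: ifPn => [le|gt]; [rewrite ifF|rewrite ifT].
  - by rewrite subrr abs2_0.
  - by apply/negbTE; rewrite notin_setE /= /B /=; exact.
  - by rewrite subr0.
  - by rewrite inE /B /=; exact/negP.
have g0 mu : (0 <= (abs2 (psi mu))%:E)%E by rewrite lee_fin abs2_ge0.
rewrite tail; set Y := \esum_(mu in _) _; pose X := \esum_(mu in setT `&` B) (abs2 (psi mu))%:E.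
have XY : norm2 psi = (X + Y)%E by apply: esumID => mu _; exact: g0.
have FX : (\sum_(mu \in F) (abs2 (psi mu))%:E <= X)%E.
  by apply: esum_ge; exists F => //; split=> // mu /FB.
have X0 : (0 <= X)%E by apply: esum_ge0 => mu _; exact: g0.
have Y0 : (0 <= Y)%E by apply: esum_ge0 => mu _; exact: g0.
move: psifin ltF; rewrite XY => fin ltF; have := lt_le_trans ltF FX.
move: fin X0 Y0 {XY FX ltF}; case: (X) (Y) => [x| |] [y| |]//= _ _ _.
by rewrite -EFinB !lte_fin -addrA gtrDl subr_lt0.
Qed.

(** Every term of the form against [psi] is 0. For the form domain the truncations serve: their
    differences are again zero modes, so the Cauchy condition in energy is trivial. *)
Lemma zero_mode_ground psi : l2 psi -> zero_mode psi -> ground psi.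
Proof.
move=> psi2 zm; split; last 2 first.
- by rewrite /l2 /= norm2_0 ltry.
- move=> phi _; have [h1 h2] := zm; rewrite /energy_form /inner.
  rewrite (_ : (fun mu => _) = fun=> 0); last first.
    apply/funext => mu; have [->|/eqP pot] := eqVneq (potential mu) 0%N; first by rewrite mul0r.
    by rewrite h1// !mulr0.
  rewrite (_ : (fun nu => \sum_(x <- _) _) = fun=> 0); last first.
    by apply/funext => nu; rewrite big_seq big1// => x xi; rewrite h2// mulr0.
  rewrite (_ : (fun mu => (phi mu)^*%R * _) = fun=> 0); last first.
    by apply/funext => mu; rewrite mulr0.
  by rewrite csum0 mulr0 addr0.
split=> //; exists (fun N => trunc N psi); split.
- by move=> N; apply: finite_support_finite_states; exact: finite_trunc.
- have tail := norm2_sub_trunc _ psi2.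
  have tail' N : norm2 (trunc N psi - psi) = norm2 (psi - trunc N psi).
    by rewrite -norm2N opprB.
  have pos N : (0 <= norm2 (psi - trunc N psi)%R)%E.
    by apply: esum_ge0 => mu _; rewrite lee_fin abs2_ge0.
  apply/fine_cvgP; split.
    have [N NP] := tail _ ltr01; exists N => // m /= Nm.
    by rewrite tail' ge0_fin_numE// (lt_trans (NP _ Nm))// ltry.
  apply/cvgrPdist_lt => e e0; have [N NP] := tail _ e0; exists N => // m /= Nm.
  rewrite sub0r normrN tail' ger0_norm ?fine_ge0// -lte_fin fineK ?NP//.
  by rewrite ge0_fin_numE// (lt_trans (NP _ Nm))// ltry.
- move=> e e0; near=> m k; rewrite zero_mode_energy ?lte_fin//.
  by apply: zero_mode_sub; exact: zero_mode_trunc.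
Unshelve. all: by end_near.
Qed.

Lemma finite_support_form_domain psi :
  finite_set [set mu | psi mu <> 0] -> form_domain kappa lambda psi.
Proof.
move=> fin; split; first exact: finite_support_l2.
exists (fun=> psi); split.
- by move=> _; exact: finite_support_finite_states.
- by rewrite subrr norm2_0; exact: cvg_cst.
- move=> e e0; near=> m k; rewrite subrr zero_mode_energy ?lte_fin//.
  by split=> [//|x nu _]; exact: q_0.
Unshelve. all: by end_near.
Qed.

(* Particle number conservation: testing with the truncations of psi itself
   makes every sum in the energy form finite. *)
Lemma ground_zero_mode psi : ground psi -> zero_mode psi.
Proof.
move=> [_ _ test]; pose g1 N mu := (potential mu)%:R * abs2 (trunc N psi mu).
pose g2 N nu := \sum_(x <- zinterval (a + 1) (b - 1)) abs2 (q lambda x (trunc N psi) nu).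
have g1_ge0 N mu : 0 <= g1 N mu by rewrite mulr_ge0 ?ler0n ?abs2_ge0.
have g2_ge0 N nu : 0 <= g2 N nu by apply: sumr_ge0 => x _; exact: abs2_ge0.
have fin1 N : (\esum_(mu in [set: config a b]) (g1 N mu)%:E < +oo)%E.
  apply: esum_finite_support => //; apply: sub_finite_set (finite_trunc N psi) => mu /= nz z.
  by apply: nz; rewrite /g1 z abs2_0 mulr0.
have fin2 N : (\esum_(nu in [set: config a b]) (g2 N nu)%:E < +oo)%E.
  apply: esum_finite_support => //.
  apply: sub_finite_set (finite_configs_sumn _ _ N) => nu /= nz.
  apply: contrapT => /negP; rewrite -ltnNge => gt; apply: nz.
  rewrite /g2 big_seq big1// => x xi; rewrite q_trunc// ifF ?abs2_0//.
  by apply/negbTE; rewrite -ltnNge (leq_trans gt)// leqW.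
have zero N : (forall mu, g1 N mu = 0) /\ (forall nu, g2 N nu = 0).
  have := test (trunc N psi) (finite_support_form_domain _ (finite_trunc N psi)).
  rewrite /energy_form /inner.
  (* Wherever [trunc N psi] or its image under [q] is nonzero, it agrees with that of [psi], so the
     mixed products are squared moduli. *)
  rewrite (_ : (fun mu => _) = fun mu => (g1 N mu)%:C); last first.
    apply/funext => mu; rewrite /g1 rmorphM /= -mul_conj_abs2 rmorph_nat /trunc.
    by case: ifP => // _; rewrite conjC0 !mul0r.
  rewrite (_ : (fun nu => \sum_(x <- _) _) = fun nu => (g2 N nu)%:C); last first.
    apply/funext => nu; rewrite /g2 rmorph_sum /= [LHS]big_seq [RHS]big_seq.
    apply: eq_bigr => x xi; rewrite -mul_conj_abs2 q_trunc//.
    by case: ifP => // _; rewrite conjC0 !mul0r.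
  rewrite (_ : (fun mu => (_ mu)^*%R * _) = fun=> 0); last first.
    by apply/funext => mu; rewrite mulr0.
  rewrite csum0 !csum_ge0// -rmorphM -rmorphD /= => /(congr1 (@complex.Re R)) /= /eqP.
  have e1 : 0 <= fine (\esum_(mu in [set: config a b]) (g1 N mu)%:E).
    by apply/fine_ge0/esum_ge0 => mu _; rewrite lee_fin.
  have e2 : 0 <= fine (\esum_(mu in [set: config a b]) (g2 N mu)%:E).
    by apply/fine_ge0/esum_ge0 => mu _; rewrite lee_fin.
  rewrite paddr_eq0 ?mulr_ge0 ?(ltW kappa_gt0)// mulf_eq0 (gt_eqF kappa_gt0) /=.
  by move=> /andP[/eqP h1 /eqP h2]; split; exact: fine_esum_eq0.
split=> [mu pot|x nu xi].
(* The truncation level is just high enough to be invisible: the particle number of [mu] here, two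
   more than that of [nu] for [q] below. *)
- have [/(_ mu) + _] := zero (sumn (word a b mu)).
  rewrite /g1 /trunc leqnn => /eqP; rewrite mulf_eq0 pnatr_eq0 abs2_eq0.
  by case/orP => /eqP.
- have [_ /(_ nu) /eqP] := zero (sumn (word a b nu)).+2.
  rewrite /g2 psumr_eq0 => [/allP/(_ x xi)/=|y _]; last exact: abs2_ge0.
  by rewrite q_trunc// leqnn abs2_eq0 => /eqP.
Qed.

Lemma zero_mode_scale (k : R[i]) psi : zero_mode psi -> zero_mode (k *: psi).
Proof.
move=> [h1 h2]; have scE mu : (k *: psi) mu = k * psi mu by [].
split=> [mu pot|x nu xi]; first by rewrite scE h1// mulr0.
have := h2 x nu xi; rewrite /q !scE => h.
by rewrite !(mulrCA _ k) -mulrBr h mulr0.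
Qed.

Lemma zero_mode_lspan A psi : A `<=` zero_mode -> lspan A psi -> zero_mode psi.
Proof.
move=> Azm [m [c [u [Au ->]]]].
have zm0 : zero_mode 0 by split=> [//|x nu _]; exact: q_0.
elim/big_ind: _ => [//|phi phi' zm zm'|i _]; last exact/zero_mode_scale/Azm.
by rewrite -(opprK phi') -[- phi']sub0r; do 2 apply: zero_mode_sub => //.
Qed.

Lemma le0_of_le_mul (x K : R) : 0 <= K -> (forall e, 0 < e -> x <= K * e) -> x <= 0.
Proof.
move=> K0 h; rewrite leNgt; apply/negP => x0.
have K1 : 0 < K + 1 by rewrite ltr_wpDl.
(* The test value is [x / (K + 1)], where the added 1 covers [K = 0]. *)
have := h _ (divr_gt0 x0 K1); rewrite mulrA ler_pdivlMr// mulrDr mulr1 mulrC.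
by rewrite -subr_ge0 opprD addNKr oppr_ge0 leNgt x0.
Qed.

(** By the parallelogram identity the two sides differ by [abs2 (y + z)]. *)
Lemma abs2_sub_le (y z : R[i]) : abs2 (y - z) <= 2 * (abs2 y + abs2 z).
Proof.
rewrite !abs2E; case: y z => y1 y2 [z1 z2] /=; rewrite -subr_ge0.
rewrite (_ : _ - _ = (y1 + z1) ^+ 2 + (y2 + z2) ^+ 2); last by ring.
by rewrite addr_ge0 ?sqr_ge0.
Qed.

(** Each condition involves at most two amplitudes, and the norm controls every single amplitude, so
    the conditions survive limits. *)
Lemma zero_mode_closed psi : (forall e : R, 0 < e ->
    exists2 phi, zero_mode phi & (norm2 (psi - phi)%R < e%:E)%E) -> zero_mode psi.
Proof.
move=> h; have close e : 0 < e -> exists2 phi, zero_mode phi &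
    forall mu, abs2 (psi mu - phi mu) <= e.
  move=> /h[phi zm lt]; exists phi => // mu; rewrite -lee_fin.
  exact: le_trans (norm2_ge (psi - phi) mu) (ltW lt).
split=> [mu pot|x nu xi]; apply/eqP; rewrite -abs2_eq0 eq_le abs2_ge0 andbT.
  apply: (@le0_of_le_mul _ 1) => // e /close[phi [h1 _] /(_ mu)].
  by rewrite h1// subr0 mul1r.
pose C1 := (Num.sqrt ((occ nu x + 1) * (occ nu x + 2))%N%:R)%:C : R[i].
pose C2 := lambda * (Num.sqrt ((occ nu (x - 1) + 1) * (occ nu (x + 1) + 1))%N%:R)%:C.
apply: (@le0_of_le_mul _ (2 * (abs2 C1 + abs2 C2))).
  by rewrite mulr_ge0// addr_ge0 ?abs2_ge0.
move=> e /close[phi [_ h2] bound].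
rewrite -[q _ _ _ _]subr0 -(h2 x nu xi) -q_sub.
rewrite /q -/C1 -/C2 (le_trans (abs2_sub_le _ _))// -[leRHS]mulrA ler_pM2l// [leRHS]mulrDl.
rewrite (ComplexField.Normc.normcM C1) (ComplexField.Normc.normcM C2) !exprMn.
by apply: lerD; (apply: ler_wpM2l; [exact: abs2_ge0|exact: bound]).
Qed.

End ground_states.

(** * The ground space spanned by BVMD-states *)

Section main.
Variables (R : realType) (kappa : R) (lambda : R[i]) (a b : int).
Hypotheses (kappa_gt0 : 0 < kappa) (lambda_neq0 : lambda != 0).
Hypothesis size_ge5 : (5 <= size (zinterval a b))%N.
Local Notation c := (lambda / (Num.sqrt 2)%:C).
Local Notation psi_ T0 := (bvmd_state a b lambda T0).
Local Notation ground := (ground_space a b kappa lambda).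
Local Notation zero_mode := (zero_mode R lambda a b).
Implicit Types (T : tiling) (mu nu : config a b) (phi psi : state R a b).

Lemma lspan1 phi psi : lspan [set phi] psi <-> exists k : R[i], psi = k *: phi.
Proof.
split=> [[m [k [u [uphi ->]]]]|[k ->]].
  by exists (\sum_(i < m) k i); rewrite scaler_suml; apply: eq_bigr => i _; rewrite uphi.
by exists 1%N, (fun=> k), (fun=> phi); split=> //; rewrite big_ord1.
Qed.

Lemma finite_support_bvmd_state T0 : root_tilings a b T0 ->
  finite_set [set mu | psi_ T0 mu <> 0].
Proof.
move=> rT0; apply: (@sub_finite_set _ _ (sigma a b @` tilings_of a b T0)).
  by move=> mu /= /bvmd_state_support[//|T [? ? ->]]; exists T => //; apply/tilings_ofE.
exact/finite_image/finite_tilings_of.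
Qed.

Lemma ground_tiling_space T0 : root_tilings a b T0 ->
  ground `&` tiling_space R a b T0 = lspan [set psi_ T0].
Proof.
move=> rT0; have T0T := rT0.1; apply/seteqP; split=> psi.
- move=> [/(ground_zero_mode _ _ _ _ _ kappa_gt0) zm [m [k [u [uket psiE]]]]].
  (* The scalar is the amplitude at the root tiling, where the BVMD-state has value 1 because a root
     contains no dimers. *)
  apply/lspan1; exists (psi (sigma a b T0)); apply/funext => mu.
  rewrite -[RHS]/(psi (sigma a b T0) * psi_ T0 mu).
  have [[T TT ->]|noT] := pselect (exists2 T, tilings_of a b T0 T & mu = sigma a b T).
    have [TT' rT] := (tilings_ofE _ _ _ _ rT0).1 TT.
    rewrite (zero_mode_root _ lambda _ _ _ lambda_neq0 zm); last exact: size_bvmd.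
    by rewrite bvmd_state_sigma// rT eqxx mulrC.
  have -> : psi_ T0 mu = 0.
    apply: contrapT => /bvmd_state_support[//|T [TT rT e]].
    by apply: noT; exists T => //; apply/tilings_ofE.
  rewrite mulr0 psiE fct_sumE big1// => i _; have [T TT e] := uket i.
  rewrite -[LHS]/(k i * u i mu) -e /ket; case: eqP => [e'|]; last by rewrite mulr0.
  by case: noT; exists T.
- move=> psispan; have zm : zero_mode psi.
    by apply: zero_mode_lspan psispan => _ ->; exact: bvmd_state_zero_mode.
  have /lspan1[k psiE] := psispan; split.
    apply: zero_mode_ground => //; apply: finite_support_l2.
    apply: sub_finite_set (finite_support_bvmd_state _ rT0) => mu /=.
    by rewrite psiE -[(k *: _) mu]/(k * psi_ T0 mu) => + z; rewrite z mulr0.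
  rewrite psiE /bvmd_state fsbig_finite; last exact: finite_tilings_of.
  rewrite scaler_sumr; under eq_bigr => T _ do rewrite scalerA.
  apply: lspan_sum => T; rewrite in_fset_set; last exact: finite_tilings_of.
  by rewrite inE => TT; exists T.
Qed.

(** The coefficients are the amplitudes at the root tilings, finitely many of them nonzero. On a
    tiling only the state of its own root contributes; elsewhere both sides vanish by
    [zero_mode_support] and [bvmd_state_support]. *)
Lemma zero_mode_finite_span psi : zero_mode psi -> finite_set [set mu | psi mu <> 0] ->
  lspan [set psi_ T0 | T0 in root_tilings a b] psi.
Proof.
move=> zm fin; pose S := [set T | root_tilings a b T /\ psi (sigma a b T) <> 0].
have finS : finite_set S.
  by apply: sub_finite_set (finite_sigma_preimage _ _ _ fin) => T [[]].
suff -> : psi = \sum_(T <- finmap.enum_fset (fset_set S)) psi (sigma a b T) *: psi_ T.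
  apply: lspan_sum => T; rewrite in_fset_set// inE => -[rT _].
  by exists T.
rewrite fct_sumE; apply/funext => mu.
under eq_bigr => T _ do rewrite -[(_ *: _) mu]/(psi (sigma a b T) * psi_ T mu).
rewrite -fsbig_finite//=.
have [[T TT ->]|noT] := pselect (exists2 T, is_bvmd a b T & mu = sigma a b T).
  rewrite (zero_mode_root _ lambda _ _ _ lambda_neq0 zm); last exact: size_bvmd.
  have rT := root_tilings_root_of _ _ _ TT.
  have other T' : S T' -> T' <> root_of T ->
      psi (sigma a b T') * psi_ T' (sigma a b T) = 0.
    by move=> [rT' _] ne; rewrite bvmd_state_sigma//; case: eqP => [/esym//|]; rewrite mulr0.
  have [z|/eqP nz] := eqVneq (psi (sigma a b (root_of T))) 0.
    rewrite z mulr0 fsbig1// => T' ST'; apply: other => // e.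
    by case: ST' => _; rewrite e.
  rewrite -(fsbig_widen [set root_of T]) ?fsbig_set1 ?bvmd_state_sigma ?eqxx 1?mulrC//.
  - by move=> _ ->.
  - by move=> T' [ST' ne]; exact: other.
rewrite fsbig1 => [|T [rT _]].
  apply: contrapT => nz; have := nz; rewrite -(wordK _ _ mu).
  move=> /(zero_mode_support _ _ _ _ _ lambda_neq0 zm _ size_ge5 (size_word _ _ mu))[T hT fT].
  apply: noT; exists T; last by rewrite -[sigma a b T]/(cfg a b (flatten T)) fT wordK.
  by apply/is_bvmdP; rewrite fT size_word.
rewrite (_ : psi_ T mu = 0) ?mulr0//; apply: contrapT => /bvmd_state_support[//|T' [TT' _ e]].
by apply: noT; exists T'.
Qed.

(** Truncations of a ground state are zero modes of finite support, hence finite combinations close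
    to it. Conversely, zero modes are closed under combinations and limits. *)
Lemma ground_closed_span :
  ground = closed_span [set psi_ T0 | T0 in root_tilings a b].
Proof.
apply/seteqP; split=> psi.
- move=> gpsi; have zm := ground_zero_mode _ _ _ _ _ kappa_gt0 _ gpsi.
  have psi2 : l2 psi by case: gpsi => -[].
  split=> // e e0; have [N /(_ N (leqnn _)) lt] := norm2_sub_trunc _ _ _ _ psi2 e e0.
  exists (trunc _ _ _ N psi) => //; apply: zero_mode_finite_span; last exact: finite_trunc.
  exact: zero_mode_trunc.
- move=> [psi2 close]; apply: zero_mode_ground => //; apply: zero_mode_closed => e e0.
  have [phi span lt] := close e e0; exists phi => //.
  by apply: zero_mode_lspan span => _ [T0 rT0 <-]; exact: bvmd_state_zero_mode.
Qed.

End main.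

Theorem theorem2p4 (R : realType) (kappa : R) (lambda : R[i]) (a b : int)
    (kappa_gt0 : 0 < kappa) (lambda_neq0 : lambda != 0)
    (size_ge5 : 5%:Z <= b - a + 1) :
  (forall T0 : tiling, root_tilings a b T0 ->
     ground_space a b kappa lambda `&` tiling_space R a b T0 =
     lspan [set bvmd_state a b lambda T0]) /\
  (forall T0 : tiling, root_tilings a b T0 -> bvmd_state a b lambda T0 <> 0) /\
  (forall T0 T1 : tiling, root_tilings a b T0 -> root_tilings a b T1 ->
     T0 <> T1 ->
     inner (bvmd_state a b lambda T0) (bvmd_state a b lambda T1) = 0) /\
  ground_space a b kappa lambda =
    closed_span [set bvmd_state a b lambda T0 | T0 in root_tilings a b].
Proof.
have n5 : (5 <= size (zinterval a b))%N.
  (* What remains is the side condition [a <= b] of [size_zinterval], obtained from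
     [1 <= b - a + 1]. *)
  rewrite -lez_nat size_zinterval// -subr_ge0 -[b - a](addrK 1) subr_ge0.
  exact: le_trans size_ge5.
split; first by move=> T0; exact: ground_tiling_space.
split; first by move=> T0; exact: bvmd_state_neq0.
split; last exact: ground_closed_span.
move=> T0 T1 r0 r1 ne; rewrite /inner (_ : (fun mu => _) = fun=> 0) ?csum0//.
apply/funext => mu; have [->|->] := bvmd_state_disjoint _ lambda _ _ _ _ mu r0 r1 ne.
  by rewrite conjC0 mul0r.
by rewrite mulr0.
Qed.
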